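(* Let $X$ be a topological space with a nonnegative, $\sigma$-finite Borel measure $\mu$, let $U\subset X\times X$ be an open neighborhood of the diagonal, and let $B_x$, $B_y^*$, $B_x^n$ be the associated balls (see context). Assume $0<\mu(B_x)<\infty$ for every $x\in X$, and that there are finite, positive constants $C$ and $\lambda_0$ with $\mu(B_x^n)\le C\lambda_0^n\mu(B_x)$ for all $x\in X$ and all positive integers $n$. Let $(W,W_+)$ be an admissible pair of weights on $X$ with exceptional set $X_0$ (possibly empty), as defined in the context. Fix $p\in[1,\infty)$. Then there is a finite constant $C'$ such that for every measurable function $f$ on $X$ satisfying (i) $\int_{X_0} f\,d\mu=0$, and (ii) $f\to0$ uniformly as $W_+\to\infty$, i.e. for every $\eta>0$ there is $M<\infty$ such that $|f(x)|\le\eta$ whenever $W_+(x)\ge M$, one has $$\int_X |f|^p\,W_+\,d\mu\;\le\; C'\int_X\left[\frac1{\mu(B_x)}\int_{B_x}|f(x)-f(y)|^p\,d\mu(y)\right]W(x)\,d\mu(x),$$ where $C'$ is independent of $f$.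
   Context: Balls: for $x,y\in X$, $B_x=B_x^1:=\{y\in X:(x,y)\in U\}$ and $B_y^*:=\{x\in X:(x,y)\in U\}$. For an integer $n\ge2$, $B_x^n$ is the union of all balls $B_z$ with $z\in B_x^{n-1}$; i.e. $y\in B_x^n$ iff there are $y_1,\dots,y_{n-1}$ such that $(x,y_1),(y_1,y_2),\dots,(y_{n-1},y)$ all lie in $U$. The set $U$ is not assumed symmetric. The constant $\lambda_0$ in the hypothesis $\mu(B_x^n)\le C\lambda_0^n\mu(B_x)$ is called the growth constant. Admissible pair: $W,W_+$ are nonnegative measurable functions on $X$ with $W_+(x)\ge W(x)$ for all $x$. The pair $(W,W_+)$ is admissible if there are constants $\lambda>\lambda_0$, $\epsilon>0$, $s\in[0,1)$ and a (measurable, possibly empty) exceptional set $X_0\subset X$ such that $$[W_+(x)]^s\,\epsilon\,\mu(B_y)\le\int_{B_x^*}[W(z)]^s\,\chi_{\{W(z)\ge\lambda W_+(x)\}}\,d\mu(z)$$ for every $x\in X\setminus X_0$ and every $y\in X$ with $(y,x)\in U$; and such that, if $X_0\neq\emptyset$, then $X_0\times X_0\subset U$ and there is a fixed finite constant $C''$ with $W_+(x)\mu(B_y)\le C''\,W(y)\,\mu(X_0)$ for all $x,y\in X_0$. Here $\chi$ denotes an indicator function. If $X_0=\emptyset$, condition (i) is vacuous.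
   Formalization: Two hypotheses are added, since the claim fails without either: U is measurable for the product of the Borel sigma-algebras, and for each x outside X_0 with W_+(x)>0 the measures of B_y are bounded over y with (y,x) in U (automatic if the admissibility integral is finite or U is symmetric). *)

(* Defs.v *)
From HB Require Import structures.
From mathcomp Require Export all_boot all_order all_algebra.
From mathcomp Require Export all_classical all_reals all_analysis.
Export Order.TTheory GRing.Theory Num.Theory.
Export numFieldNormedType.Exports.

Set Implicit Arguments.
Unset Strict Implicit.
Unset Printing Implicit Defensive.

Local Open Scope classical_set_scope.
Local Open Scope ring_scope.

(* [borel X] is convertible to [X]; it only carries the Borel sigma-algebra. *)
Notation borel X := (g_sigma_algebraType (@open X)).

Section Balls.
Context {X : Type}.
Implicit Types U : set (X * X).

(* B_x = {y | (x, y) \in U} *)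
Definition uball U (x : X) : set X := xsection U x.

(* B_y^* = {x | (x, y) \in U} *)
Definition uball_star U (y : X) : set X := ysection U y.

(* B_x^n for n >= 1; the value at n = 0 is a dummy. *)
Definition uball_iter U (n : nat) (x : X) : set X :=
  iter n.-1 (fun A : set X => \bigcup_(z in A) uball U z) (uball U x).

End Balls.

Section Weights.
Context {R : realType} {X : ptopologicalType}.

(* lam0 is the growth constant, X0 the exceptional set.  For s = 0 the power
   [0 `^ 0] is 1. *)
Definition admissible (mu : set (borel X) -> \bar R) (U : set (X * X))
    (lam0 : R) (W Wp : X -> R) (X0 : set X) : Prop :=
  [/\ measurable_fun [set: borel X] W, measurable_fun [set: borel X] Wp,
      forall x, 0 <= W x, forall x, W x <= Wp x
    & measurable (X0 : set (borel X))] /\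
  exists lam eps s : R,
    [/\ lam0 < lam, 0 < eps, 0 <= s < 1,
        (forall x y, ~ X0 x -> U (y, x) ->
          ((Wp x `^ s * eps)%:E * mu (uball U y) <=
           \int[mu]_(z in uball_star U x)
             (W z `^ s * \1_[set z' | (lam * Wp x <= W z')%R] z)%:E)%E)
      & (X0 !=set0 ->
          X0 `*` X0 `<=` U /\
          exists C'' : R, forall x y, X0 x -> X0 y ->
            ((Wp x)%:E * mu (uball U y) <= (C'' * W y)%:E * mu X0)%E)].

End Weights.

(* Main.v *)
Require Import Defs.
From mathcomp Require Import measurable_realfun ring lra.

(* For x outside X0 with W_+(x) > 0 let a particle jump from x to a random z
   with x in B_z and W(z) >= lam W_+(x), with a density K(x, z) proportional to
   (a truncation of) W(z)^s / mu(B_z).  Admissibility gives total mass 1 together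
   with W_+(x) K(x, z) <= A W(z) / mu(B_z).  Let K_n be the density of n jumps
   from x to z: it forces x in B_z^n and W(z) >= lam^n W_+(x), whence
     int W_+(x) K_n(x, z) dmu(x) <= A' lam^-n W(z) mu(B_z^n) / mu(B_z)
                                 <= A'' (lam0 / lam)^n W(z),
   which is summable since lam > lam0.  Telescoping f along the trajectories
   bounds int |f|^p W_+ by the energy plus a contribution of X0.  Trajectories
   that never reach X0 see W_+ grow without bound, so replacing |f| by
   (|f| - eta)_+ makes the telescoping sums finite.  On X0 the mean of f
   vanishes, and |f(x)|^p is bounded by the average of |f(x) - f(y)|^p. *)

Local Open Scope classical_set_scope.
Local Open Scope ring_scope.

(** * Nonnegative kernels: normalisation, iteration and potential estimates *)

Section Kernels.
Set Implicit Arguments.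
Unset Strict Implicit.
Context d (T : measurableType d) (R : realType).
Context (mu : {sigma_finite_measure set T -> \bar R}).
Local Open Scope ereal_scope.
Import HBNNSimple.
Implicit Types (b : T * T -> R) (K : T * T -> \bar R) (E F w : T -> \bar R).

(* Monotonicity of the integral of nonnegative functions needs no
   measurability, since that integral is a supremum over simple functions. *)
Lemma ge0_integral_mono (nu : {measure set T -> \bar R}) (D : set T)
    (f g : T -> \bar R) :
  (forall x, D x -> 0 <= f x) -> (forall x, D x -> f x <= g x) ->
  \int[nu]_(x in D) f x <= \int[nu]_(x in D) g x.
Proof.
move=> f0 fg; rewrite !ge0_integralE//; last first.
  by move=> x Dx; exact: le_trans (f0 x Dx) (fg x Dx).
apply: ereal_sup_le => _ [h /= hf <-].
exists h => //= x; apply: (le_trans (hf x)).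
rewrite !patchE; case: ifPn => // /[!inE]; exact: fg.
Qed.

Lemma measurable_section_integral K : measurable_fun [set: T * T] K ->
  (forall xz, 0 <= K xz) -> measurable_fun setT (fun x => \int[mu]_z K (x, z)).
Proof. exact: measurable_fun_fubini_tonelli_F. Qed.

Lemma measurable_section K x : measurable_fun [set: T * T] K ->
  measurable_fun setT (fun z => K (x, z)).
Proof. by move=> mK; apply: measurableT_comp => //; exact: measurable_pair1. Qed.

Lemma measurable_comp_fst d' (S : measurableType d') (g : T -> S) :
  measurable_fun setT g -> measurable_fun [set: T * T] (fun xz => g xz.1).
Proof. by move=> mg; exact: (measurableT_comp mg measurable_fst). Qed.

Lemma measurable_comp_snd d' (S : measurableType d') (g : T -> S) :
  measurable_fun setT g -> measurable_fun [set: T * T] (fun xz => g xz.2).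
Proof. by move=> mg; exact: (measurableT_comp mg measurable_snd). Qed.

Lemma ge0_measurable_funV d' (S : measurableType d') (g : S -> R) :
  measurable_fun setT g -> (forall x, (0 <= g x)%R) ->
  measurable_fun setT (fun x => (g x)^-1)%R.
Proof.
(* On nonnegative reals the inverse is the power of exponent -1, also at 0, where both are 0. *)
move=> mg g0; have -> : (fun x => (g x)^-1)%R = (@powR R ^~ (- 1))%R \o g.
  by apply/funext => x /=; rewrite powR_inv1.
by apply: measurableT_comp => //; exact: measurable_powR.
Qed.

(* The mass of [b (x, .)] may be infinite, so [b] is first truncated at a level
   depending measurably on [x]. *)
Lemma exists_normalized_subkernel b (G : set T) :
  measurable_fun [set: T * T] b -> (forall xz, (0 <= b xz)%R) -> measurable G ->
  (forall x, G x -> 1 <= \int[mu]_z (b (x, z))%:E) ->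
  exists K, [/\ measurable_fun [set: T * T] K, forall xz, 0 <= K xz,
    forall xz, K xz <= 2%:E * (b xz)%:E,
    forall x, G x -> \int[mu]_z K (x, z) = 1
    & forall x z, ~ G x -> K (x, z) = 0].
Proof.
move=> mb b0 mG b1.
have [A TA mA] := sigma_finiteT mu.
pose A' n := \big[setU/set0]_(i < n) A i.
have mA' n : measurable (A' n).
  by apply: bigsetU_measurable => i _; have [] := mA i.
have fA' n : mu (A' n) < +oo.
  rewrite /A'; elim: n => [|n IH]; first by rewrite big_ord0 measure0.
  rewrite big_ord_recr/=; have [mAn fAn] := mA n.
  by rewrite (le_lt_trans (measureU2 _ _ _)) ?lte_add_pinfty//; exact: mA'.
(* Cutting [b] off at height n and restricting it to the finite-measure set [A' n] makes each mass
   [N n x] finite, while [c n] increases to [b]. *)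
pose c n (xz : T * T) := (Num.min (b xz) n%:R * \1_(A' n) xz.2)%R.
have c0 n xz : (0 <= c n xz)%R by rewrite mulr_ge0// le_min b0/=.
have cb n xz : (c n xz <= b xz)%R.
  rewrite /c indicE; case: (_ \in _); rewrite ?mulr1 ?mulr0//.
  by rewrite ge_min lexx.
have mc n : measurable_fun [set: T * T] (c n).
  apply: measurable_funM; first by apply: measurable_minr => //; exact: measurable_cst.
  by apply: measurable_comp_snd; exact: measurable_indic.
have mcE n : measurable_fun [set: T * T] (EFin \o c n) by apply/measurable_EFinP.
pose N n x := \int[mu]_z (c n (x, z))%:E.
have N0 n x : 0 <= N n x by apply: integral_ge0 => z _; rewrite lee_fin.
have Nfin n x : N n x \is a fin_num.
  rewrite ge0_fin_numE//.
  apply: (@le_lt_trans _ _ (\int[mu]_z (n%:R%:E * (\1_(A' n) z)%:E))).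
    apply: ge0_integral_mono => z _; first by rewrite lee_fin.
    by rewrite -EFinM lee_fin ler_wpM2r// ge_min lexx orbT.
  rewrite ge0_integralZl//; last first.
    by apply: measurableT_comp => //; exact: measurable_indic.
  by rewrite integral_indic// setIT lte_mul_pinfty//; exact: fA'.
have mN n : measurable_fun setT (N n).
  by apply: (@measurable_section_integral (EFin \o c n)) => // xz; rewrite lee_fin.
(* By monotone convergence the masses [N n x] tend to the mass of [b (x, .)], which is at least 1
   and so exceeds 1/2. *)
have Nlarge x : G x -> exists n, 2^-1%:E <= N n x.
  move=> Gx; apply: contrapT => /forallNP Nx.
  have ndc z : {homo (fun n => (c n (x, z))%:E) : n m / (n <= m)%N >-> n <= m}.
    move=> n m nm; rewrite lee_fin ler_pM//.
    - by rewrite le_min b0/=.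
    - by rewrite le_min !ge_min lexx/= ler_nat nm orbT.
    - rewrite !indicE; have [/set_mem A'z|//] := boolP (z \in A' n).
      have A'nm : A' n `<=` A' m := @subset_bigsetU _ A _ _ nm.
      by rewrite mem_set//; exact: A'nm.
  have := @cvg_monotone_convergence _ _ _ mu setT measurableT
    (fun n z => (c n (x, z))%:E) (fun n => measurable_section x (mcE n)).
  move=> /(_ (fun n z _ => c0 n (x, z)) (fun z _ => ndc z)) cvgN.
  have : \int[mu]_z limn (fun n => (c n (x, z))%:E) <= 2^-1%:E.
    rewrite -(cvg_lim _ cvgN)//; apply: lime_le; first by apply/cvg_ex; eexists; exact: cvgN.
    by apply: nearW => n; apply: ltW; rewrite ltNge; exact/negP/Nx.
  apply/negP; rewrite -ltNge.
  suff <- : \int[mu]_z (b (x, z))%:E = \int[mu]_z limn (fun n => (c n (x, z))%:E).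
    by apply: lt_le_trans (b1 _ Gx); rewrite lte_fin invf_lt1// ltr1n.
  apply: eq_integral => z _; apply/esym/cvg_lim => //; apply: cvg_near_cst.
  have [k _ Akz] : (\bigcup_i A i) z by rewrite -TA.
  near=> n; rewrite /c/= indicE mem_set ?mulr1; last first.
    by rewrite /A'; apply: (@bigsetU_sup _ k) => //; near: n; exact: nbhs_infty_gt.
  congr EFin; apply/min_idPl; near: n; exact: nbhs_infty_ger.
(* [D n] collects the points of [G] for which n is the first level of mass at least 1/2. Dividing
   [c n] by that mass gives total mass 1 and costs at most a factor 2; for each x at most one term
   of the series below survives. *)
pose D := seqDU (fun n => G `&` [set x | 2^-1%:E <= N n x]).
have mD n : measurable (D n).
  have mGN k : measurable (G `&` [set x | 2^-1%:E <= N k x]).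
    by rewrite setIC -[X in X `&` _]setTI; apply: measurableI => //; exact: measurable_lee.
  by apply: measurableD => //; apply: bigsetU_measurable.
pose g n (xz : T * T) := (\1_(D n) xz.1 * (c n xz / fine (N n xz.1)))%:E.
have g0 n xz : 0 <= g n xz.
  by rewrite lee_fin; apply: mulr_ge0 => //; apply: divr_ge0; rewrite ?c0 ?fine_ge0.
have mg n : measurable_fun [set: T * T] (g n).
  apply/measurable_EFinP; apply: measurable_funM.
    by apply: measurable_comp_fst; exact: measurable_indic.
  apply: measurable_funM => //.
  apply: (@measurable_comp_fst _ _ (fun x => (fine (N n x))^-1)%R).
  apply: ge0_measurable_funV => [|x]; last by rewrite fine_ge0.
  by apply: (measurableT_comp (f := fine)).
exists (fun xz => \sum_(n <oo) g n xz).
have gD n x z : D n x -> \sum_(n <oo) g n (x, z) = g n (x, z).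
  move=> Dnx; rewrite (nneseriesD1 (n := n))// eseries0 ?adde0// => k _ kn.
  rewrite /g indicE memNset ?mul0r// => Dkx.
  have := @trivIset_seqDU _ (fun n => G `&` [set x | 2^-1%:E <= N n x]).
  move=> /(_ k n I I); rewrite -/D => knE; move/eqP: kn; apply; apply: knE.
  by exists x.
have gND x z : ~ G x -> \sum_(n <oo) g n (x, z) = 0.
  move=> Gx; apply: eseries0 => k _ _; rewrite /g indicE memNset ?mul0r//.
  by case=> -[].
have GD x : G x -> exists n, D n x.
  move=> Gx; have [n Nx] := Nlarge _ Gx.
  have : (\bigcup_n D n) x by rewrite -seqDU_bigcup_eq; exists n.
  by case=> k _; exists k.
split => //.
- by apply: (@ge0_emeasurable_sum _ _ _ _ _ predT) => // *.
- by move=> xz; exact: nneseries_ge0.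
- move=> [x z]; have [Gx|nGx] := pselect (G x); last by rewrite gND// -EFinM lee_fin mulr_ge0.
  have [n Dnx] := GD _ Gx; rewrite (gD n)// /g -EFinM lee_fin/= indicE mem_set// mul1r.
  have [[_ /= Nx] _] := Dnx.
  have fN : (2^-1 <= fine (N n x))%R by rewrite -lee_fin fineK.
  rewrite mulrC ler_pM// ?invr_ge0 ?fine_ge0//.
  by rewrite -[leRHS]invrK lef_pV2// posrE// (lt_le_trans _ fN).
- move=> x Gx; have [n Dnx] := GD _ Gx.
  have [[_ /= Nx] _] := Dnx.
  under eq_integral do rewrite (gD n)// /g indicE mem_set// mul1r mulrC EFinM/=.
  rewrite ge0_integralZl//; last 3 first.
  - exact: (measurable_section x (mcE n)).
  - by move=> z _; rewrite lee_fin.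
  - by rewrite lee_fin invr_ge0 fine_ge0.
  rewrite -/(N n x) -[X in _ * X](fineK (Nfin n x)) -EFinM mulVf//.
  by rewrite gt_eqF// -lte_fin fineK// (lt_le_trans _ Nx)// lte_fin.
Unshelve. all: by end_near.
Qed.
(* The index is shifted: [kiter K n] is the density of [n + 1] steps. *)
Fixpoint kiter K (n : nat) : T * T -> \bar R :=
  if n is m.+1 then
    fun xy => \int[mu]_z (kiter K m (xy.1, z) * K (z, xy.2))
  else K.

Context K (mK : measurable_fun [set: T * T] K) (K0 : forall xz, 0 <= K xz).

Lemma kiter_ge0 n xy : 0 <= kiter K n xy.
Proof.
elim: n xy => [//|n IH] xy /=.
by apply: integral_ge0 => z _; rewrite mule_ge0.
Qed.

Lemma measurable_kiter n : measurable_fun [set: T * T] (kiter K n).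
Proof.
elim: n => [//|n IH] /=.
pose f (p : (T * T) * T) := kiter K n (p.1.1, p.2) * K (p.2, p.1.2).
apply: (@measurable_fun_fubini_tonelli_F _ _ _ _ _ mu f); last first.
  by move=> p; rewrite mule_ge0// kiter_ge0.
have m1 : measurable_fun [set: (T * T) * T] (fun p => p.1.1).
  by apply: (measurableT_comp (f := fst)); exact: measurable_fst.
have m2 : measurable_fun [set: (T * T) * T] (fun p => p.1.2).
  by apply: (measurableT_comp (f := snd)); [exact: measurable_snd|exact: measurable_fst].
have m3 : measurable_fun [set: (T * T) * T] (fun p => p.2) by exact: measurable_snd.
apply: emeasurable_funM.
- exact: (measurableT_comp IH (measurable_fun_pair m1 m3)).
- exact: (measurableT_comp mK (measurable_fun_pair m3 m2)).
Qed.

(** The recursion appends a jump at the end. By Tonelli that jump may act on [F] first, so composing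
    kernels becomes composing integral operators. *)
Lemma integral_kiterS n x F : measurable_fun setT F -> (forall y, 0 <= F y) ->
  \int[mu]_y (kiter K n.+1 (x, y) * F y) =
  \int[mu]_z (kiter K n (x, z) * \int[mu]_y (K (z, y) * F y)).
Proof.
move=> mF F0 /=.
have mk := measurable_section x (measurable_kiter n).
pose f (zy : T * T) := kiter K n (x, zy.1) * (K zy * F zy.2).
have mKF : measurable_fun [set: T * T] (fun zy => K zy * F zy.2).
  by apply: emeasurable_funM => //; exact: measurable_comp_snd.
have mf : measurable_fun [set: T * T] f.
  apply: emeasurable_funM => //.
  exact: (measurable_comp_fst (g := fun z => kiter K n (x, z))).
have f0 zy : 0 <= f zy by rewrite /f mule_ge0 ?kiter_ge0// mule_ge0.
transitivity (\int[mu]_y \int[mu]_z f (z, y)).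
  apply: eq_integral => y _; rewrite -ge0_integralZr//; last 2 first.
  - apply: emeasurable_funM => //.
    exact: (measurableT_comp mK (measurable_pair2 y)).
  - by move=> z _; rewrite mule_ge0// kiter_ge0.
  by apply: eq_integral => z _; rewrite /f muleA.
rewrite -fubini_tonelli//; apply: eq_integral => z _.
rewrite -ge0_integralZl//.
- exact: (measurable_section z mKF).
- by move=> y _; rewrite mule_ge0.
- exact: kiter_ge0.
Qed.

Lemma kiter_mass_le1 n x :
  (forall z, \int[mu]_y K (z, y) <= 1) -> \int[mu]_y kiter K n (x, y) <= 1.
Proof.
move=> K1; elim: n x => [//|n IH] x.
under eq_integral do rewrite -[kiter _ _ _]mule1.
rewrite integral_kiterS//; apply: le_trans (IH x).
apply: ge0_integral_mono => z _; last first.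
  rewrite -[leRHS]mule1 lee_wpmul2l ?kiter_ge0//.
  by under eq_integral do rewrite mule1.
by rewrite mule_ge0 ?kiter_ge0//; apply: integral_ge0 => y _; rewrite mule1.
Qed.

(** The integral of the zero function vanishes, so support properties of [K] pass to its iterates at
    every point and not only almost everywhere. *)
Lemma kiterS_neq0 n x y : kiter K n.+1 (x, y) != 0 ->
  exists2 z, kiter K n (x, z) != 0 & K (z, y) != 0.
Proof.
move=> /= knz; apply: contrapT => /forall2NP nz; move/eqP: knz; apply.
rewrite integral0_eq// => z _; apply/eqP; rewrite mule_eq0.
by have [/negP/negPn->//|/negP/negPn->] := nz z; rewrite orbT.
Qed.

(** The inequality for [F] is substituted repeatedly into its own last term. A partial Neumann
    series in [E] builds up, and what is left of [F] is evaluated after n + 1 jumps. *)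
Lemma kiter_iterate q E F x n : (0 <= q)%R ->
  measurable_fun setT E -> (forall z, 0 <= E z) ->
  measurable_fun setT F -> (forall z, 0 <= F z) ->
  (forall z, F z <= E z + q%:E * \int[mu]_y (K (z, y) * F y)) ->
  F x <= E x + \sum_(0 <= k < n) (q ^+ k.+1)%:E * \int[mu]_z (kiter K k (x, z) * E z)
         + (q ^+ n.+1)%:E * \int[mu]_z (kiter K n (x, z) * F z).
Proof.
move=> q0 mE E0 mF F0 FE; elim: n => [|n IH].
  by rewrite big_geq// adde0 expr1.
rewrite big_nat_recr//= (le_trans IH)// -!addeA leeD2l// leeD2l//.
have mk := measurable_section x (measurable_kiter n).
have mKF : measurable_fun setT (fun z => \int[mu]_y (K (z, y) * F y)).
  apply: (@measurable_section_integral (fun zy => K zy * F zy.2)).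
    by apply: emeasurable_funM => //; exact: measurable_comp_snd.
  by move=> zy; rewrite mule_ge0.
have KF0 z : 0 <= \int[mu]_y (K (z, y) * F y).
  by apply: integral_ge0 => y _; rewrite mule_ge0.
rewrite integral_kiterS// [(q ^+ n.+2)%R]exprSr EFinM -muleA -ge0_muleDr//; last 2 first.
- by apply: integral_ge0 => z _; rewrite mule_ge0 ?kiter_ge0.
- by rewrite mule_ge0// integral_ge0// => z _; rewrite mule_ge0 ?kiter_ge0.
rewrite lee_wpmul2l// ?lee_fin ?exprn_ge0//.
rewrite -ge0_integralZl//; last 2 first.
- exact: emeasurable_funM.
- by move=> z _; rewrite mule_ge0 ?kiter_ge0.
rewrite -ge0_integralD//; last 4 first.
- by move=> z _; rewrite mule_ge0 ?kiter_ge0.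
- exact: emeasurable_funM.
- by move=> z _; rewrite !mule_ge0 ?kiter_ge0.
- by apply: measurable_funeM; exact: emeasurable_funM.
apply: ge0_integral_mono => z _; first by rewrite mule_ge0 ?kiter_ge0.
by rewrite muleCA -ge0_muleDr ?mule_ge0// lee_wpmul2l ?kiter_ge0.
Qed.

(* Integrates [kiter_iterate] against [w]; by Tonelli, the [n]-th term is
   controlled by the image of [w] under [n + 1] steps. *)
Lemma potential_bound q c r E F w : (0 <= q)%R -> (0 <= c)%R -> (0 <= r)%R ->
  (q * r < 1)%R ->
  measurable_fun setT E -> (forall z, 0 <= E z) ->
  measurable_fun setT F -> (forall z, 0 <= F z) ->
  measurable_fun setT w -> (forall z, 0 <= w z) ->
  (forall z, F z <= E z + q%:E * \int[mu]_y (K (z, y) * F y)) ->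
  (forall x, w x != 0 -> exists n, forall z, kiter K n (x, z) * F z = 0) ->
  (forall n z, \int[mu]_x (w x * kiter K n (x, z)) <= (c * r ^+ n)%:E * w z) ->
  \int[mu]_x (w x * F x) <= (1 + q * c / (1 - q * r))%:E * \int[mu]_x (w x * E x).
Proof.
move=> q0 c0 r0 qr1 mE E0 mF F0 mw w0 FE wF wk.
have mkE n : measurable_fun [set: T * T] (fun xz => kiter K n xz * E xz.2).
  by apply: emeasurable_funM; [exact: measurable_kiter|exact: measurable_comp_snd].
have kE0 n xz : 0 <= kiter K n xz * E xz.2 by rewrite mule_ge0 ?kiter_ge0.
pose V n x := \int[mu]_z (kiter K n (x, z) * E z).
have V0 n x : 0 <= V n x by apply: integral_ge0 => z _; exact: (kE0 n (x, z)).
have mV n : measurable_fun setT (V n).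
  exact: (measurable_section_integral (mkE n)).
pose S k x := (q ^+ k.+1)%:E * (w x * V k x).
have S0 k x : 0 <= S k x by rewrite /S ?mule_ge0 ?lee_fin ?exprn_ge0.
have mS k : measurable_fun setT (S k).
  by apply: measurable_funeM; exact: emeasurable_funM.
have qV0 k x : 0 <= (q ^+ k.+1)%:E * V k x.
  by rewrite mule_ge0 ?lee_fin ?exprn_ge0.
(* The iteration stops at an n, depending on x, whose remainder vanishes; bounding the finite sum by
   the whole series removes that dependence. *)
have wFS x : w x * F x <= w x * E x + \sum_(k <oo) S k x.
  have [->|wx] := eqVneq (w x) 0.
    by rewrite !mul0e add0e nneseries_ge0.
  have [n kF] := wF _ wx.
  have := kiter_iterate x n q0 mE E0 mF F0 FE.
  under [in X in _ + X]eq_integral do rewrite kF.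
  rewrite integral0 mule0 adde0 => /(lee_wpmul2l (w0 x)) /le_trans; apply.
  rewrite ge0_muleDr//; last first.
    by apply: sume_ge0 => k _; exact: qV0.
  rewrite leeD2l// ge0_sume_distrr//; last first.
    by move=> k _; exact: qV0.
  apply: le_trans (nneseries_lim_ge n _) => //.
  by apply: lee_sum => k _; rewrite muleCA.
apply: (@le_trans _ _ (\int[mu]_x (w x * E x + \sum_(k <oo) S k x))).
  by apply: ge0_integral_mono => x _; rewrite ?mule_ge0.
rewrite ge0_integralD//; last 4 first.
- by move=> x _; rewrite mule_ge0.
- exact: emeasurable_funM.
- by move=> x _; exact: nneseries_ge0.
- by apply: (@ge0_emeasurable_sum _ _ _ _ _ predT).
rewrite integral_nneseries//.
set I := \int[mu]_x (w x * E x).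
have I0 : 0 <= I by apply: integral_ge0 => x _; rewrite mule_ge0.
(* Tonelli integrates over the starting point first, where [wk] gives back the weight [w z]; the
   k-th term is then geometric of ratio [q * r]. *)
have Sk k : \int[mu]_x S k x <= (q * c * (q * r) ^+ k)%:E * I.
  rewrite ge0_integralZl//; last 3 first.
  - exact: emeasurable_funM.
  - by move=> x _; rewrite mule_ge0.
  - by rewrite lee_fin exprn_ge0.
  have -> : (q * c * (q * r) ^+ k = q ^+ k.+1 * (c * r ^+ k))%R.
    by rewrite exprS exprMn; ring.
  rewrite EFinM -muleA lee_wpmul2l ?lee_fin ?exprn_ge0//.
  pose f (xz : T * T) := w xz.1 * (kiter K k xz * E xz.2).
  have mf : measurable_fun [set: T * T] f.
    by apply: emeasurable_funM => //; exact: measurable_comp_fst.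
  have f0 xz : 0 <= f xz by rewrite mule_ge0.
  have -> : \int[mu]_x (w x * V k x) = \int[mu]_x \int[mu]_z f (x, z).
    apply: eq_integral => x _; rewrite -ge0_integralZl//; last first.
      exact: (measurable_section x (mkE k)).
  rewrite fubini_tonelli// /I -ge0_integralZl//; last 3 first.
  - exact: emeasurable_funM.
  - by move=> x _; rewrite mule_ge0.
  - by rewrite lee_fin mulr_ge0// exprn_ge0.
  apply: ge0_integral_mono => z _; first by apply: integral_ge0 => x _.
  rewrite /f/= muleA; under eq_integral do rewrite muleA.
  rewrite ge0_integralZr//; last 2 first.
  - apply: emeasurable_funM => //.
    exact: (measurableT_comp (measurable_kiter k) (measurable_pair2 z)).
  - by move=> x _; rewrite mule_ge0 ?kiter_ge0.
  by rewrite lee_wpmul2r.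
rewrite EFinD ge0_muleDl ?lee_fin//; last first.
  by rewrite divr_ge0 ?mulr_ge0// subr_ge0 ltW.
rewrite mul1e leeD2l//; apply: lime_le.
  by apply: is_cvg_nneseries => k _ _; exact: integral_ge0.
apply: nearW => n.
apply: (@le_trans _ _ (\sum_(0 <= k < n) ((q * c * (q * r) ^+ k)%:E * I))).
  exact: lee_sum.
rewrite -ge0_sume_distrl; last first.
  by move=> k _; rewrite lee_fin !mulr_ge0// exprn_ge0// mulr_ge0.
rewrite lee_wpmul2r// sumEFin lee_fin -mulr_sumr ler_wpM2l ?mulr_ge0//.
rewrite -[leRHS]mul1r ler_pdivlMr ?subr_gt0//.
rewrite big_mkord mulrC -opprB mulNr -subrX1 opprB gerBl exprn_ge0//.
by rewrite mulr_ge0.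
Qed.
End Kernels.

(** * Elementary inequalities for real powers *)

Section PowerInequalities.
Set Implicit Arguments.
Unset Strict Implicit.
Context (R : realType).

(* Compare [b] with [k * a], where [(1 + k) `^ p = q]. *)
Lemma powRD_le (p q : R) : 0 < p -> 1 < q ->
  exists2 M : R, 0 <= M & forall a b, 0 <= a -> 0 <= b ->
    (a + b) `^ p <= q * a `^ p + M * b `^ p.
Proof.
move=> p0 q1; pose k := q `^ p^-1 - 1.
have k0 : 0 < k.
  have : 1 `^ p^-1 < q `^ p^-1.
    by rewrite gt0_ltr_powR ?invr_gt0 ?nnegrE// ltW// (lt_trans ltr01).
  by rewrite powR1 subr_gt0.
exists ((1 + k^-1) `^ p) => [|a b a0 b0]; first exact: powR_ge0.
have [bka|kab] := leP b (k * a).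
  have -> : q = (1 + k) `^ p.
    rewrite addrC subrK -powRrM mulVf ?gt_eqF// powRr1// ltW//.
    by rewrite (lt_trans ltr01).
  rewrite -powRM//; last by rewrite addr_ge0// ltW.
  rewrite ler_wpDr ?mulr_ge0 ?powR_ge0//.
  have abk : a + b <= (1 + k) * a by rewrite mulrDl mul1r lerD2l.
  have ab0 := addr_ge0 a0 b0.
  apply: ge0_ler_powR => //; first exact: ltW.
  by rewrite nnegrE (le_trans ab0).
have kV0 : 0 <= k^-1 by rewrite invr_ge0 ltW.
rewrite -powRM//; last by rewrite addr_ge0.
rewrite ler_wpDl ?mulr_ge0 ?powR_ge0// ?(ltW (lt_trans ltr01 q1))//.
have abk : a + b <= (1 + k^-1) * b.
  by rewrite mulrDl mul1r addrC lerD2l// ler_pdivlMl// ltW.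
have ab0 := addr_ge0 a0 b0.
apply: ge0_ler_powR => //; first exact: ltW.
by rewrite nnegrE (le_trans ab0).
Qed.

(* Split according to whether [2 * g <= a]. *)
Lemma powR_absorb (p a g : R) : 1 <= p -> 0 < a -> 0 <= g ->
  a `^ (p - 1) * g <= 2^-1 * a `^ p + 2 `^ (p - 1) * g `^ p.
Proof.
move=> p1 a0 g0.
have powRS (y : R) : 0 <= y -> y `^ p = y `^ (p - 1) * y.
  move=> y0; have [->|y1] := eqVneq y 0.
    by rewrite mulr0 powR0// gt_eqF// (lt_le_trans ltr01).
  rewrite -[in LHS](subrK 1 p) (powRD (r := p - 1)) ?powRr1//.
  by rewrite y1 implybT.
have [ga|ag] := leP (2 * g) a.
  rewrite ler_wpDr ?mulr_ge0 ?powR_ge0// (powRS a (ltW a0)) mulrCA ler_wpM2l ?powR_ge0//.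
  by rewrite ler_pdivlMl.
rewrite ler_wpDl ?mulr_ge0 ?powR_ge0// (powRS g)// mulrA -powRM//.
by rewrite ler_wpM2r// ge0_ler_powR ?subr_ge0 ?nnegrE// ?mulr_ge0 ?(ltW a0)// ltW.
Qed.

End PowerInequalities.

(** * Pointwise bound for functions of mean zero *)

Section ZeroMean.
Set Implicit Arguments.
Unset Strict Implicit.
Context d (T : measurableType d) (R : realType).
Context (mu : {measure set T -> \bar R}).

(** As the mean is zero, |f(x)| mu(A) is at most the integral of |f(x) - f(y)| over A. Multiplying
    by |f(x)|^(p-1) and applying [powR_absorb] under the integral produces half of the left side
    plus a multiple of [J]; the half is finite and is absorbed. *)
Lemma zero_mean_le (A : set T) (f : T -> R) (p : R) x : 1 <= p ->
  measurable A -> (mu A < +oo)%E -> measurable_fun setT f ->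
  (\int[mu]_(y in A) (f y)%:E = 0)%E ->
  ((`|f x| `^ p)%:E * mu A <=
   (2 * 2 `^ (p - 1))%:E * \int[mu]_(y in A) (`|f x - f y| `^ p)%:E)%E.
Proof.
move=> p1 mA Afin mf f0.
have p0 : 0 < p by exact: lt_le_trans ltr01 p1.
set J := (\int[mu]_(y in A) _)%E.
have J0 : (0 <= J)%E by apply: integral_ge0 => y _; rewrite lee_fin powR_ge0.
have [fx0|fx0] := eqVneq (f x) 0.
  by rewrite fx0 normr0 powR0 ?gt_eqF// mul0e mule_ge0// lee_fin mulr_ge0// powR_ge0.
have a0 : 0 < `|f x| by rewrite normr_gt0.
set a := `|f x| in a0 *.
have mfA : measurable_fun A f by exact: measurable_funTS.
(* A finite integral forces integrability, because the difference of two infinite parts is not a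
   finite number. *)
have intf : mu.-integrable A (EFin \o f).
  apply/integrableP; split; first exact/measurable_EFinP.
  by rewrite integral_fin_num_abs// f0.
have intc (c : R) : mu.-integrable A (EFin \o cst c).
  apply/integrableP; split; first exact/measurable_EFinP.
  by rewrite (integral_cst mu mA `|c|%:E) lte_mul_pinfty.
have mg : measurable_fun A (fun y => `|f x - f y|).
  by apply: measurableT_comp => //; exact: measurable_funB.
have mgp : measurable_fun A (fun y => (`|f x - f y| `^ p)%:E).
  apply/measurable_EFinP.
  exact: (measurableT_comp (measurable_powR p) mg).
have meanE : (a%:E * mu A <= \int[mu]_(y in A) `|f x - f y|%:E)%E.
  have -> : (a%:E * mu A = `|\int[mu]_(y in A) ((f x)%:E - (f y)%:E)|)%E.
    rewrite (integralB_EFin mA (intc (f x)) intf).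
    by rewrite f0 sube0 (integral_cst mu mA (f x)%:E) abseM/= (gee0_abs (measure_ge0 mu A)).
  apply: le_trans (le_abse_integral _ _ _) _ => //.
  by apply/measurable_EFinP; exact: measurable_funB.
have {meanE} : ((a `^ p)%:E * mu A <=
    (2^-1 * a `^ p)%:E * mu A + (2 `^ (p - 1))%:E * J)%E.
  have apE : a `^ p = a `^ (p - 1) * a.
    rewrite -[in LHS](subrK 1 p) (powRD (r := p - 1)) ?powRr1 ?ltW//.
    by rewrite (gt_eqF a0) implybT.
  rewrite {1}apE EFinM -muleA (le_trans (lee_wpmul2l _ meanE))// ?lee_fin ?powR_ge0//.
  rewrite -ge0_integralZl//; last 2 first.
  - exact/measurable_EFinP.
  - by rewrite lee_fin powR_ge0.
  rewrite -(integral_cst mu mA (2^-1 * a `^ p)%:E) /J -ge0_integralZl//.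
  rewrite -ge0_integralD//; last 2 first.
  - by move=> y _; rewrite /= lee_fin mulr_ge0 ?powR_ge0.
  - exact: measurable_funeM.
  apply: ge0_integral_mono => y _; first by rewrite -EFinM lee_fin mulr_ge0// powR_ge0.
  rewrite -!EFinM -EFinD lee_fin.
  exact: powR_absorb.
have k0 : 0 < 2 `^ (p - 1) :> R by rewrite powR_gt0.
move: J0; case: J => [J J0| _ _|//]; last first.
  by rewrite [leRHS]gt0_muley ?leey// lte_fin mulr_gt0.
have Afn : mu A \is a fin_num by rewrite ge0_fin_numE.
rewrite -(fineK Afn) -!EFinM -EFinD !lee_fin; lra.
Qed.

End ZeroMean.

(** * Construction of the jump kernel from admissibility *)

Section DescentKernel.
Set Implicit Arguments.
Unset Strict Implicit.
Context d (T : measurableType d) (R : realType).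
Context (mu : {sigma_finite_measure set T -> \bar R}) (U : set (T * T)).
Context (lam eps s : R) (W Wp : T -> R) (X0 : set T).
Local Open Scope ereal_scope.
Let m z := fine (mu (uball U z)).
(** The points from which a jump is made. Where [Wp] vanishes there is no weight to control, and the
    density constructed below divides by the s-th power of [Wp x]. *)
Let G := ~` X0 `&` [set x | (0 < Wp x)%R].

Context (U_meas : measurable U) (U_diag : forall x, U (x, x))
  (mu_ball : forall x, 0 < mu (uball U x) < +oo)
  (mW : measurable_fun setT W) (mWp : measurable_fun setT Wp)
  (W0 : forall x, (0 <= W x)%R)
  (mX0 : measurable X0) (lam1 : (1 < lam)%R) (eps0 : (0 < eps)%R)
  (s01 : (0 <= s < 1)%R)
  (adm : forall x y, ~ X0 x -> U (y, x) ->
    (Wp x `^ s * eps)%:E * mu (uball U y) <=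
    \int[mu]_(z in uball_star U x)
      (W z `^ s * \1_[set z' | (lam * Wp x <= W z')%R] z)%:E)
  (ball_bnd : forall x, ~ X0 x -> (0 < Wp x)%R ->
    exists M : R, forall y, U (y, x) -> mu (uball U y) <= M%:E).

Lemma uball_measureE z : mu (uball U z) = (m z)%:E.
Proof. by have /andP[mz0 mzoo] := mu_ball z; rewrite /m fineK// ge0_fin_numE. Qed.

Lemma uball_measure_gt0 z : (0 < m z)%R.
Proof. by rewrite -lte_fin -uball_measureE; have /andP[] := mu_ball z. Qed.

Lemma measurable_uball_measure : measurable_fun setT m.
Proof.
apply: (measurableT_comp (f := fine)) => //.
exact: measurable_fun_xsection.
Qed.

Lemma measurable_descent_domain : measurable G.
Proof.
apply: measurableI; first exact: measurableC.
rewrite -[X in measurable X]setTI.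
have : measurable_fun setT (fun x => 0 < Wp x)%R by exact: measurable_fun_ltr.
by move=> /(_ measurableT [set true]); apply.
Qed.

(** Before truncation the density is W(z)^s / (eps mu(B_z) W_+(x)^s) on the allowed jumps;
    admissibility gives it mass at least 1. There W_+(x) <= W(z), hence W_+(x)^(1-s) <= W(z)^(1-s),
    which completes W(z)^s to W(z) in the last bound. The factor 2 comes from the normalisation. *)
Lemma exists_descent_kernel : exists K : T * T -> \bar R,
  [/\ measurable_fun [set: T * T] K, forall xz, 0 <= K xz,
      forall x, G x -> \int[mu]_z K (x, z) = 1,
      forall x z, ~ G x -> K (x, z) = 0
    & (forall x z, K (x, z) != 0 -> U (z, x) /\ (lam * Wp x <= W z)%R) /\
      (forall x z, (Wp x)%:E * K (x, z) <= (2 / eps * (W z / m z))%:E)].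
Proof.
have /andP[s0 s1] := s01.
pose S : set (T * T) := [set xz | G xz.1] `&`
  ([set xz | U (xz.2, xz.1)] `&` [set xz | (lam * Wp xz.1 <= W xz.2)%R]).
have mS : measurable S.
  apply: measurableI.
    rewrite -[X in measurable X]setTI.
    exact: (@measurable_fst _ _ T T measurableT _ measurable_descent_domain).
  apply: measurableI.
    rewrite -[X in measurable X]setTI.
    exact: (@measurable_swap _ _ T T measurableT _ U_meas).
  rewrite -[X in measurable X]setTI; apply: measurable_fun_le => //.
    apply: (@measurable_comp_fst _ _ _ _ (fun x => lam * Wp x)%R).
    exact: measurable_funM.
  exact: (measurable_comp_snd mW).
pose b (xz : T * T) : R := (\1_S xz *
  (W xz.2 `^ s * ((eps * m xz.2)^-1 * (Wp xz.1 `^ s)^-1)))%R.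
have mb : measurable_fun setT b.
  apply: measurable_funM; first exact: measurable_indic.
  apply: measurable_funM.
    apply: (@measurable_comp_snd _ _ _ _ (fun z => W z `^ s)%R).
    exact: (measurableT_comp (measurable_powR s) mW).
  apply: measurable_funM.
    apply: (@measurable_comp_snd _ _ _ _ (fun z => (eps * m z)^-1)%R).
    apply: ge0_measurable_funV.
      by apply: measurable_funM => //; exact: measurable_uball_measure.
    by move=> z; rewrite mulr_ge0 ?ltW ?uball_measure_gt0.
  apply: (@measurable_comp_fst _ _ _ _ (fun x => (Wp x `^ s)^-1)%R).
  apply: ge0_measurable_funV; last by move=> x; exact: powR_ge0.
  exact: (measurableT_comp (measurable_powR s) mWp).
have b0 xz : (0 <= b xz)%R.
  rewrite !mulr_ge0 ?powR_ge0// invr_ge0 ?powR_ge0//.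
  by rewrite mulr_ge0 ?ltW ?uball_measure_gt0.
have b1 x : G x -> 1 <= \int[mu]_z (b (x, z))%:E.
  move=> Gx; have [nX0x /= Wpx] := Gx.
  have [M mM] := ball_bnd nX0x Wpx.
  (* [sup A] bounds [m z] for all [z] with [U (z, x)], so that [m z] in [b] may be
     replaced by the constant [sup A], for which admissibility is optimal. *)
  pose A := [set m y | y in [set y | U (y, x)]].
  have supA : has_sup A.
    split; first by exists (m x), x => //; exact: U_diag.
    by exists M => _ [y Uyx <-]; rewrite -lee_fin -uball_measureE mM.
  have mA y : U (y, x) -> (m y <= sup A)%R.
    by move=> Uyx; apply: sup_ubound; [case: supA|exists y].
  have A0 : (0 < sup A)%R := lt_le_trans (uball_measure_gt0 x) (mA _ (U_diag x)).
  have Ws0 : (0 < Wp x `^ s)%R by rewrite powR_gt0.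
  pose g z := (W z `^ s * \1_[set z' | (lam * Wp x <= W z')%R] z)%:E.
  pose I := \int[mu]_(z in uball_star U x) g z.
  have gE z : g z = (W z `^ s * \1_[set z' | (lam * Wp x <= W z')%R] z)%:E by [].
  have g0 z : 0 <= g z by rewrite gE lee_fin mulr_ge0// powR_ge0.
  have mB : measurable (uball_star U x) by exact: measurable_ysection.
  have mg : measurable_fun setT g.
    apply/measurable_EFinP/measurable_funM.
      exact: (measurableT_comp (measurable_powR s) mW).
    by apply: measurable_indic; rewrite -[X in measurable X]setTI; exact: measurable_fun_le.
  have supI : (Wp x `^ s * eps * sup A)%:E <= I.
    have I0 : 0 <= I by exact: integral_ge0.
    have AI y : U (y, x) -> (Wp x `^ s * eps * m y)%:E <= I.
      by move=> Uyx; rewrite EFinM -uball_measureE; exact: adm.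
    case: I I0 AI => [i _ AI| _ _|//]; last by rewrite leey.
    rewrite lee_fin mulrC -ler_pdivlMr ?mulr_gt0//.
    apply: ge_sup; first by case: supA.
    by move=> _ [y Uyx <-]; rewrite ler_pdivlMr ?mulr_gt0// mulrC -lee_fin AI.
  have {}supI : 1 <= ((Wp x `^ s * eps * sup A)^-1)%:E * I.
    apply: le_trans (lee_wpmul2l _ supI); last by rewrite lee_fin invr_ge0 !mulr_ge0// ltW.
    by rewrite -EFinM mulVf// gt_eqF// !mulr_gt0.
  apply: (le_trans supI); rewrite /I integral_mkcond -ge0_integralZl//; last 3 first.
  - exact/(measurable_restrictT _ mB)/measurable_funTS.
  - by move=> z _; exact: erestrict_ge0.
  - by rewrite lee_fin invr_ge0 !mulr_ge0// ltW.
  apply: ge0_integral_mono => z _.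
    rewrite mule_ge0//; first by rewrite lee_fin invr_ge0 !mulr_ge0// ltW.
    exact: erestrict_ge0.
  rewrite patchE; case: ifPn => [|_]; last by rewrite mule0 lee_fin.
  rewrite inE /uball_star /ysection/= inE => Uzx.
  rewrite gE -EFinM lee_fin indicE.
  have [/set_mem /= lz|_] := boolP (z \in _); last by rewrite !mulr0.
  rewrite /b indicE mem_set//= mulr1 mul1r mulrC ler_wpM2l ?powR_ge0//.
  rewrite -invfM lef_pV2 ?posrE ?mulr_gt0 ?uball_measure_gt0//.
  by rewrite mulrC mulrA ler_wpM2l ?mA// mulr_ge0// ltW.
have [K [mK K0 Kb K1 KG]] := exists_normalized_subkernel mb b0 measurable_descent_domain b1.
have bS x z : K (x, z) != 0 -> S (x, z).
  move=> Kxz; apply: contrapT => nS; move/eqP: Kxz; apply.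
  apply/eqP; rewrite eq_le K0 andbT (le_trans (Kb _))//.
  by rewrite /b indicE memNset// mul0r mule0.
exists K; split => //; split => x z.
  by move=> /bS[/= _ []].
have rhs0 : (0 <= 2 / eps * (W z / m z))%R.
  by rewrite mulr_ge0// divr_ge0// ltW// uball_measure_gt0.
have [->|/bS Sxz] := eqVneq (K (x, z)) 0; first by rewrite mule0 lee_fin.
have [[/= _ Wpx] [/= _ lWz]] := Sxz.
apply: le_trans (lee_wpmul2l _ (Kb (x, z))) _; first by rewrite lee_fin ltW.
rewrite -!EFinM lee_fin /b indicE mem_set//= mul1r.
have Wz : (Wp x <= W z)%R by rewrite (le_trans _ lWz)// ler_peMl ?ltW.
have Wz0 : (0 < W z)%R := lt_le_trans Wpx Wz.
have WzE : (W z = W z `^ s * W z `^ (1 - s))%R.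
  rewrite -powRD; last by rewrite (gt_eqF Wz0) implybT.
  by rewrite addrC subrK powRr1// ltW.
have -> : (Wp x * (2 * (W z `^ s * ((eps * m z)^-1 / Wp x `^ s))) =
    2 / eps * (W z `^ s * (Wp x / Wp x `^ s) / m z))%R by rewrite invfM; ring.
rewrite ler_wpM2l ?divr_ge0 ?(ltW eps0)// ler_wpM2r ?invr_ge0 ?(ltW (uball_measure_gt0 z))//.
rewrite [leRHS]WzE ler_wpM2l ?powR_ge0//.
have -> : (Wp x / Wp x `^ s = Wp x `^ (1 - s))%R.
  by rewrite powRB ?powRr1 ?(ltW Wpx)// (gt_eqF Wpx) implybT.
apply: ge0_ler_powR => //; rewrite ?nnegrE ?subr_ge0.
- exact: ltW.
- exact: ltW.
- exact: ltW.
Qed.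
End DescentKernel.

(** * Chains of balls and growth of powers *)

Section IteratedBalls.
Set Implicit Arguments.
Unset Strict Implicit.

(** Bernoulli's inequality. All later exponents are covered because the applications use [n.+1]. *)
Lemma exists_expr_ge (R : realType) (x M : R) : 1 < x ->
  exists n, forall k, (n <= k)%N -> M <= x ^+ k.
Proof.
move=> x1; have x10 : 0 < x - 1 by rewrite subr_gt0.
have bern n : (x - 1) *+ n <= x ^+ n.
  elim: n => [|n IH]; first by rewrite mulr0n expr0.
  rewrite mulrS exprS -[X in X * _](subrK 1 x) mulrDl mul1r lerD//.
  by rewrite ler_peMr ?(ltW x10)// exprn_ege1// ltW.
exists (Num.bound (`|M| / (x - 1))) => k nk; apply: le_trans (bern k).
rewrite -mulr_natl -ler_pdivrMr//.
apply: (@le_trans _ _ (`|M| / (x - 1))).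
  by rewrite ler_pM2r ?invr_gt0// ler_norm.
apply: (@le_trans _ _ (Num.bound (`|M| / (x - 1)))%:R); last by rewrite ler_nat.
by apply/ltW/archi_boundP; rewrite divr_ge0// ltW.
Qed.

Context (T : Type) (U : set (T * T)).

(** [uball_iter] extends a chain at its far end. A further jump from z to y, where U(y, z) holds,
    puts y in front of the chain from z back to x, hence the induction. *)
Lemma uball_iterS n x y z : U (y, z) ->
  uball_iter U n.+1 z x -> uball_iter U n.+2 y x.
Proof.
move=> Uyz; elim: n x => [|n IH] x.
  by move=> Uzx; exists z => //=; rewrite /uball /xsection/= inE.
by case=> x' /IH zx' Ux'x; exists x'.
Qed.

Lemma uball_sub_iter n x : (forall x, U (x, x)) -> uball U x `<=` uball_iter U n.+1 x.
Proof.
move=> Udiag; elim: n => [//|n IH] y /IH xy; exists y => //.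
by rewrite /uball /xsection/= inE; exact: Udiag.
Qed.

End IteratedBalls.

(** * Support and weighted mass of the iterated kernel *)

Section IteratedKernel.
Set Implicit Arguments.
Unset Strict Implicit.
Context d (T : measurableType d) (R : realType).
Context (mu : {sigma_finite_measure set T -> \bar R}) (U : set (T * T)).
Context (C lam0 lam A : R) (W Wp : T -> R) (K : T * T -> \bar R).
Local Open Scope ereal_scope.
Let m z := fine (mu (uball U z)).

(** Since B_x is contained in every B_x^n, 1 <= C lam0^n for all n >= 1. If lam0 < 1, some n has (C
    + 1) lam0^n <= 1, a contradiction. This is what makes lam > 1 available. *)
Lemma growth_constant_ge1 x : measurable U -> (forall x, U (x, x)) ->
  0 < mu (uball U x) < +oo -> (0 < lam0)%R ->
  (forall n, measurable (uball_iter U n x)) ->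
  (forall n, (0 < n)%N ->
    mu (uball_iter U n x) <= (C * lam0 ^+ n)%:E * mu (uball U x)) ->
  (1 <= lam0)%R.
Proof.
move=> mU Udiag /andP[mu0 muoo] lam00 mUn growth.
have mufin : mu (uball U x) \is a fin_num by rewrite ge0_fin_numE.
have C1 n : (1 <= C * lam0 ^+ n.+1)%R.
  have : mu (uball U x) <= (C * lam0 ^+ n.+1)%:E * mu (uball U x).
    apply: le_trans (growth n.+1 _) => //.
    apply: le_measure; rewrite ?inE//; first exact: measurable_xsection.
    exact: uball_sub_iter.
  rewrite -[X in X <= _]mul1e -(fineK mufin) -!EFinM lee_fin ler_pM2r//.
  by rewrite -lte_fin fineK.
rewrite leNgt; apply/negP => lam01.
have [n nC] := exists_expr_ge (C + 1) (etrans (invf_gt1 lam00) lam01).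
have := nC n.+1 (leqnSn n); rewrite exprVn -[leRHS]mul1r ler_pdivlMr ?exprn_gt0// mulrDl mul1r.
have : (0 < lam0 ^+ n.+1)%R by exact: exprn_gt0.
by move: (C1 n) => + + /=; lra.
Qed.

Context (mu_ball : forall x, 0 < mu (uball U x) < +oo)
  (mUn : forall n x, measurable (uball_iter U n x))
  (C0 : (0 < C)%R) (lam00 : (0 < lam0)%R)
  (growth : forall x n, (0 < n)%N ->
    mu (uball_iter U n x) <= (C * lam0 ^+ n)%:E * mu (uball U x))
  (W0 : forall x, (0 <= W x)%R) (WWp : forall x, (W x <= Wp x)%R)
  (lam1 : (1 < lam)%R) (A0 : (0 <= A)%R)
  (mK : measurable_fun [set: T * T] K) (K0 : forall xz, 0 <= K xz)
  (K1 : forall x, \int[mu]_z K (x, z) <= 1)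
  (Ksupp : forall x z, K (x, z) != 0 -> U (z, x) /\ (lam * Wp x <= W z)%R)
  (Kle : forall x z, (Wp x)%:E * K (x, z) <= (A * (W z / m z))%:E).

(** Each jump gains a factor lam, because W <= W_+ at the intermediate point. The n + 1 jumps of
    [kiter K n] match the index [n.+1] of the ball. *)
Lemma kiter_support n x y : kiter mu K n (x, y) != 0 ->
  uball_iter U n.+1 y x /\ (lam ^+ n.+1 * Wp x <= W y)%R.
Proof.
elim: n y => [|n IH] y.
  by move=> /Ksupp; rewrite expr1 /uball_iter/= /uball /xsection/= inE.
move=> /(kiterS_neq0 (d := d)) [z /IH[xz lxz] /Ksupp[Uyz lzy]].
split; first exact: uball_iterS xz.
rewrite exprS -mulrA (le_trans _ lzy)// ler_wpM2l ?(ltW (lt_trans ltr01 _))//.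
exact: le_trans (WWp z).
Qed.

(** The first n jumps lead to some z with W_+(x) <= W_+(z) / lam^n and have total mass at most 1;
    the last jump is estimated by [Kle] at z. Hence only n factors lam for n + 1 jumps. *)
Lemma weighted_kiter_le n x y :
  (Wp x)%:E * kiter mu K n (x, y) <= (A * (W y / m y) / lam ^+ n)%:E.
Proof.
have Wp0 z : (0 <= Wp z)%R := le_trans (W0 z) (WWp z).
have lam_gt0 : (0 < lam)%R := lt_trans ltr01 lam1.
have lamX k : (0 < lam ^+ k)%R by exact: exprn_gt0.
case: n => [|n]; first by rewrite expr0 divr1.
rewrite /=; set c := (A * _ / _)%R.
have c0 : (0 <= c)%R.
  rewrite !mulr_ge0 ?invr_ge0// ?(ltW (lamX _))//.
  by rewrite fine_ge0.
have mk := measurable_section x (measurable_kiter mu mK K0 n).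
have mKy : measurable_fun setT (fun z => K (z, y)).
  exact: (measurableT_comp mK (measurable_pair2 y)).
have k0 z : 0 <= kiter mu K n (x, z) by exact: kiter_ge0.
rewrite -ge0_integralZl//; last 3 first.
- exact: emeasurable_funM.
- by move=> z _; rewrite mule_ge0.
- by rewrite lee_fin.
apply: (@le_trans _ _ (\int[mu]_z (kiter mu K n (x, z) * c%:E))).
  apply: ge0_integral_mono => z _; first by rewrite !mule_ge0// lee_fin.
  have [->|knz] := eqVneq (kiter mu K n (x, z)) 0; first by rewrite !mul0e mule0.
  rewrite muleCA lee_wpmul2l//.
  have [_ lxz] := kiter_support knz.
  have Wpxz : (Wp x <= Wp z / lam ^+ n.+1)%R.
    by rewrite ler_pdivlMr// mulrC (le_trans lxz).
  apply: (@le_trans _ _ ((Wp z / lam ^+ n.+1)%:E * K (z, y))).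
    by rewrite lee_wpmul2r// lee_fin.
  rewrite mulrC EFinM -muleA /c mulrC EFinM lee_wpmul2l//.
  by rewrite lee_fin invr_ge0 ltW.
rewrite ge0_integralZr// -[leRHS]mul1e lee_wpmul2r ?lee_fin//.
exact: kiter_mass_le1.
Qed.

(** The starting points lie in B_y^(n+1), so the pointwise bound is multiplied by the measure of
    that ball; mu(B_y) cancels and the surplus lam0 enters the constant. Passing from W(y) to W_+(y)
    gives the same weight on both sides, as [potential_bound] requires. *)
Lemma integral_weighted_kiter_le n y :
  \int[mu]_x ((Wp x)%:E * kiter mu K n (x, y)) <=
  (A * C * lam0 * (lam0 / lam) ^+ n)%:E * (Wp y)%:E.
Proof.
have Wp0 z : (0 <= Wp z)%R := le_trans (W0 z) (WWp z).
have lam_gt0 : (0 < lam)%R := lt_trans ltr01 lam1.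
have lamX k : (0 < lam ^+ k)%R by exact: exprn_gt0.
have my0 : (0 < m y)%R by exact: uball_measure_gt0.
pose c := (A * (W y / m y) / lam ^+ n)%R.
have c0 : (0 <= c)%R.
  by rewrite !mulr_ge0 ?invr_ge0// ?(ltW (lamX _))// ltW.
apply: (@le_trans _ _ (\int[mu]_x (c%:E * (\1_(uball_iter U n.+1 y) x)%:E))).
  apply: ge0_integral_mono => x _.
    by rewrite mule_ge0 ?lee_fin// kiter_ge0.
  have [->|/kiter_support[yx _]] := eqVneq (kiter mu K n (x, y)) 0.
    by rewrite mule0 -EFinM lee_fin mulr_ge0.
  by rewrite indicE mem_set// mule1; exact: weighted_kiter_le.
rewrite ge0_integralZl//; last first.
  by apply/measurable_EFinP; exact: measurable_indic.
rewrite integral_indic// setIT.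
apply: le_trans (lee_wpmul2l _ (growth y (ltn0Sn n))) _; first by rewrite lee_fin.
rewrite (uball_measureE mu_ball) -!EFinM lee_fin.
have -> : (c * (C * lam0 ^+ n.+1 * fine (mu (uball U y))) =
    A * C * lam0 * (lam0 / lam) ^+ n * W y)%R.
  rewrite /c expr_div_n exprS -/(m y).
  have -> : (W y = W y / m y * m y)%R by rewrite divfK// gt_eqF.
  by rewrite mulfK ?gt_eqF//; ring.
by rewrite ler_wpM2l// !mulr_ge0 ?exprn_ge0 ?divr_ge0 ?(ltW C0) ?(ltW lam00) ?(ltW lam_gt0).
Qed.

End IteratedKernel.

(** * Energy estimates and the weighted inequality *)

Section WeightedPoincare.
Set Implicit Arguments.
Unset Strict Implicit.
Context d (T : measurableType d) (R : realType).
Context (mu : {sigma_finite_measure set T -> \bar R}) (U : set (T * T)).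
Context (C lam0 lam A p : R) (W Wp : T -> R) (X0 : set T) (K : T * T -> \bar R).
Local Open Scope ereal_scope.
Implicit Types f : T -> R.
Let m z := fine (mu (uball U z)).
Let G := ~` X0 `&` [set x | (0 < Wp x)%R].

(** The indicator of [U] replaces a variable domain of integration, so that Tonelli can exchange the
    centre and the point of the ball. *)
Definition energy_density f (xy : T * T) : \bar R :=
  (\1_U xy * ((m xy.1)^-1 * `|f xy.1 - f xy.2| `^ p * W xy.1))%:E.

Definition energy f := \int[mu]_x \int[mu]_y energy_density f (x, y).

Context (U_meas : measurable U)
  (mu_ball : forall x, 0 < mu (uball U x) < +oo)
  (mW : measurable_fun setT W) (mWp : measurable_fun setT Wp)
  (W0 : forall x, (0 <= W x)%R) (WWp : forall x, (W x <= Wp x)%R)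
  (mX0 : measurable X0) (p1 : (1 <= p)%R).

Let p0 : (0 < p)%R := lt_le_trans ltr01 p1.
Let m0 z : (0 < m z)%R := uball_measure_gt0 mu_ball z.
Let Wp0 z : (0 <= Wp z)%R := le_trans (W0 z) (WWp z).

Lemma measurable_diff_pow f : measurable_fun setT f ->
  measurable_fun [set: T * T] (fun xy => `|f xy.1 - f xy.2| `^ p)%R.
Proof.
move=> mf; apply: (measurableT_comp (measurable_powR p)).
apply: measurableT_comp => //.
by apply: measurable_funB; [exact: measurable_comp_fst|exact: measurable_comp_snd].
Qed.

Lemma measurable_energy_density f : measurable_fun setT f ->
  measurable_fun [set: T * T] (energy_density f).
Proof.
move=> mf; apply/measurable_EFinP; apply: measurable_funM.
  exact: measurable_indic.
apply: measurable_funM; last exact: measurable_comp_fst.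
apply: measurable_funM; last exact: measurable_diff_pow.
apply: (@measurable_comp_fst _ _ _ _ (fun x => (m x)^-1)%R).
apply: ge0_measurable_funV; first exact: measurable_uball_measure.
by move=> x; exact: ltW.
Qed.

Lemma energy_density_ge0 f xy : 0 <= energy_density f xy.
Proof.
by rewrite lee_fin !mulr_ge0 ?powR_ge0// invr_ge0 ltW.
Qed.

Lemma energy_ge0 f : 0 <= energy f.
Proof.
apply: integral_ge0 => x _; apply: integral_ge0 => y _.
exact: energy_density_ge0.
Qed.

Lemma energyE f : measurable_fun setT f ->
  energy f = \int[mu]_x ((m x)^-1%:E *
    (\int[mu]_(y in uball U x) (`|f x - f y| `^ p)%:E) * (W x)%:E).
Proof.
move=> mf; apply: eq_integral => x _.
have mB : measurable (uball U x) by exact: measurable_xsection.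
have mfx : measurable_fun setT (fun y => (`|f x - f y| `^ p)%:E).
  apply/measurable_EFinP; exact: (measurableT_comp (measurable_diff_pow mf) (measurable_pair1 x)).
rewrite -ge0_integralZl//; last 2 first.
- exact: measurable_funTS.
- by rewrite lee_fin invr_ge0 ltW.
rewrite -ge0_integralZr//; last 3 first.
- by apply: measurable_funeM; exact: measurable_funTS.
- by move=> y _; rewrite -EFinM lee_fin mulr_ge0 ?powR_ge0// invr_ge0 ltW.
- by rewrite lee_fin.
rewrite [RHS]integral_mkcond; apply: eq_integral => y _.
rewrite patchE /energy_density indicE /uball mem_xsection/=.
by case: (_ \in U); rewrite ?mul1r ?mul0r.
Qed.

(** A jump from x ends at a centre z with x in B_z, so the kernel estimates produce the energy with
    the centre as inner variable. *)
Lemma energy_swap f : measurable_fun setT f ->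
  energy f = \int[mu]_x \int[mu]_z energy_density f (z, x).
Proof.
move=> mf; apply: fubini_tonelli; first exact: measurable_energy_density.
exact: energy_density_ge0.
Qed.

(** [zero_mean_le] bounds |f(x)|^p by an average over X0. The second condition on X0 trades W_+(x) /
    mu(X0) for a multiple of W(y) / mu(B_y), and X0 x X0 inside U makes the result part of the
    energy with centre y. *)
Lemma exceptional_bound :
  (X0 !=set0 -> X0 `*` X0 `<=` U /\
    exists C'' : R, forall x y, X0 x -> X0 y ->
      (Wp x)%:E * mu (uball U y) <= (C'' * W y)%:E * mu X0) ->
  exists2 C3 : R, (0 <= C3)%R & forall f, measurable_fun setT f ->
    \int[mu]_(x in X0) (f x)%:E = 0 ->
    \int[mu]_(x in X0) (`|f x| `^ p * Wp x)%:E <= C3%:E * energy f.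
Proof.
move=> X0cond.
have mfW f : measurable_fun setT f ->
    measurable_fun X0 (fun x => (`|f x| `^ p * Wp x)%:E).
  move=> mf; apply/measurable_funTS/measurable_EFinP/measurable_funM => //.
  apply: (measurableT_comp (measurable_powR p)).
  exact: measurableT_comp.
have [muX0|muX0] := eqVneq (mu X0) 0.
  exists 0%R => // f mf _; rewrite mul0e.
  by rewrite null_set_integral//; exact: mfW.
have [x0 X0x0] : X0 !=set0.
  by apply/set0P; apply: contra_neq muX0 => ->; rewrite measure0.
have [X0U [C'' hC'']] : X0 `*` X0 `<=` U /\ exists C'' : R, forall x y, X0 x -> X0 y ->
      (Wp x)%:E * mu (uball U y) <= (C'' * W y)%:E * mu X0 by apply: X0cond; exists x0.
(* [X0] lies in the ball of any of its points. *)
have X0fin : mu X0 < +oo.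
  apply: (@le_lt_trans _ _ (mu (uball U x0))); last by have /andP[] := mu_ball x0.
  apply: le_measure; rewrite ?inE//; first exact: measurable_xsection.
  by move=> y X0y; rewrite /uball /xsection/= inE; apply: X0U.
have X0fn : mu X0 \is a fin_num by rewrite ge0_fin_numE.
set n0 := fine (mu X0).
have muX0E : mu X0 = n0%:E by rewrite fineK.
have n00 : (0 < n0)%R by rewrite -lte_fin -muX0E lt0e muX0/=.
pose k := (2 * 2 `^ (p - 1) : R)%R.
have k0 : (0 <= k)%R by rewrite mulr_ge0// powR_ge0.
(* The sign of [C''] is not given; its absolute value keeps the constant nonnegative. *)
exists (k * `|C''|)%R => [|f mf f0]; first by rewrite mulr_ge0.
have kC0 : (0 <= k * `|C''|)%R by rewrite mulr_ge0.
rewrite energy_swap// -ge0_integralZl//; last 2 first.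
- apply: (@measurable_fun_fubini_tonelli_G _ _ _ _ _ mu (energy_density f)).
    exact: measurable_energy_density.
  exact: energy_density_ge0.
- by move=> x _; apply: integral_ge0 => y _; exact: energy_density_ge0.
rewrite [leLHS]integral_mkcond; apply: ge0_integral_mono => x _.
  by apply: erestrict_ge0 => y _; rewrite lee_fin mulr_ge0 ?powR_ge0.
rewrite patchE; case: ifPn => [/set_mem X0x|_]; last first.
  by rewrite mule_ge0 ?lee_fin//; apply: integral_ge0 => y _; exact: energy_density_ge0.
have mEx : measurable_fun setT (fun z => energy_density f (z, x)).
  exact: (measurableT_comp (measurable_energy_density mf) (measurable_pair2 x)).
rewrite -ge0_integralZl//; last by move=> y _; exact: energy_density_ge0.
have mfx : measurable_fun X0 (fun y => (`|f x - f y| `^ p)%:E).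
  apply/measurable_funTS/measurable_EFinP.
  exact: (measurableT_comp (measurable_diff_pow mf) (measurable_pair1 x)).
apply: (@le_trans _ _ (\int[mu]_(y in X0)
    ((Wp x / n0 * k)%:E * (`|f x - f y| `^ p)%:E))).
  rewrite ge0_integralZl//; last first.
    by rewrite lee_fin !mulr_ge0// invr_ge0 ltW.
  rewrite [in leRHS]EFinM -muleA.
  have zm : (`|f x| `^ p)%:E * n0%:E <=
      k%:E * \int[mu]_(y in X0) (`|f x - f y| `^ p)%:E.
    by rewrite -muX0E; exact: zero_mean_le.
  apply: le_trans (lee_wpmul2l _ zm); last by rewrite lee_fin divr_ge0// ltW.
  by rewrite -!EFinM lee_fin mulrCA divfK ?gt_eqF.
rewrite [leLHS]integral_mkcond; apply: ge0_integral_mono => y _.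
  apply: erestrict_ge0 => z _.
  by rewrite -EFinM lee_fin !mulr_ge0 ?powR_ge0// invr_ge0 ltW.
rewrite patchE; case: ifPn => [/set_mem X0y|_]; last first.
  by rewrite mule_ge0 ?energy_density_ge0 ?lee_fin.
rewrite /energy_density indicE mem_set; last exact: X0U.
rewrite /= mul1r -!EFinM lee_fin distrC.
have Wxy : (Wp x / n0 <= `|C''| * (W y / m y))%R.
  have := hC'' _ _ X0x X0y.
  rewrite (uball_measureE mu_ball) muX0E -!EFinM lee_fin => h.
  rewrite ler_pdivrMr// mulrA mulrAC ler_pdivlMr// (le_trans h)// ler_wpM2r ?(ltW n00)//.
  by rewrite ler_wpM2r// ler_norm.
apply: le_trans (ler_wpM2r _ (ler_wpM2r k0 Wxy)) _; first exact: powR_ge0.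
by rewrite le_eqVlt; apply/orP; left; apply/eqP; ring.
Qed.

Context (C0 : (0 < C)%R) (lam00 : (0 < lam0)%R)
  (mUn : forall n x, measurable (uball_iter U n x))
  (growth : forall x n, (0 < n)%N ->
    mu (uball_iter U n x) <= (C * lam0 ^+ n)%:E * mu (uball U x))
  (lam1 : (1 < lam)%R) (lamlam0 : (lam0 < lam)%R) (A0 : (0 <= A)%R)
  (mK : measurable_fun [set: T * T] K) (K0 : forall xz, 0 <= K xz)
  (K1 : forall x, G x -> \int[mu]_z K (x, z) = 1)
  (KG : forall x z, ~ G x -> K (x, z) = 0)
  (Ksupp : forall x z, K (x, z) != 0 -> U (z, x) /\ (lam * Wp x <= W z)%R)
  (Kle : forall x z, (Wp x)%:E * K (x, z) <= (A * (W z / m z))%:E).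

Lemma kernel_energy_le f : measurable_fun setT f ->
  \int[mu]_x ((Wp x)%:E *
    \int[mu]_z (K (x, z) * (`|f x - f z| `^ p)%:E)) <= A%:E * energy f.
Proof.
move=> mf.
rewrite energy_swap// -ge0_integralZl//; last 2 first.
- apply: (@measurable_fun_fubini_tonelli_G _ _ _ _ _ mu (energy_density f)).
    exact: measurable_energy_density.
  exact: energy_density_ge0.
- by move=> x _; apply: integral_ge0 => y _; exact: energy_density_ge0.
have Kf0 x z : 0 <= K (x, z) * (`|f x - f z| `^ p)%:E.
  by rewrite mule_ge0// lee_fin powR_ge0.
apply: ge0_integral_mono => x _.
  by apply: mule_ge0; [rewrite lee_fin|exact: integral_ge0].
have mEx : measurable_fun setT (fun z => energy_density f (z, x)).
  exact: (measurableT_comp (measurable_energy_density mf) (measurable_pair2 x)).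
have mfx : measurable_fun setT (fun y => (`|f x - f y| `^ p)%:E).
  apply/measurable_EFinP.
  exact: (measurableT_comp (measurable_diff_pow mf) (measurable_pair1 x)).
rewrite -ge0_integralZl//; last 2 first.
- by apply: emeasurable_funM => //; exact: measurable_section.
- by rewrite lee_fin.
rewrite -ge0_integralZl//; last by move=> y _; exact: energy_density_ge0.
apply: ge0_integral_mono => z _; first by rewrite mule_ge0 ?lee_fin.
have [->|/Ksupp[Uzx _]] := eqVneq (K (x, z)) 0.
  by rewrite mul0e mule0 mule_ge0 ?energy_density_ge0 ?lee_fin.
rewrite muleA; apply: le_trans (lee_wpmul2r _ (Kle x z)) _.
  by rewrite lee_fin powR_ge0.
rewrite /energy_density indicE mem_set// mul1r/= -!EFinM lee_fin distrC.
by rewrite le_eqVlt; apply/orP; left; apply/eqP; ring.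
Qed.

(** [potential_bound] is applied to the p-th power of (|f| - eta)_+ with weight [Wp]. The constant
    is fixed before [f], [eta] and [M], so that eta can later tend to 0. *)
Lemma truncated_bound : exists2 C1 : R, (0 <= C1)%R &
  forall f (eta M : R), measurable_fun setT f -> (0 <= eta)%R ->
  (forall x, (M <= Wp x)%R -> (`|f x| <= eta)%R) ->
  \int[mu]_x ((Wp x)%:E * (Num.max (`|f x| - eta) 0 `^ p)%:E) <=
  C1%:E * (A%:E * energy f + \int[mu]_(x in X0) (`|f x| `^ p * Wp x)%:E).
Proof.
(* Midpoint of 1 and lam / lam0: q > 1 is needed for [powRD_le], and q lam0 / lam < 1 for the
   geometric series. *)
pose q := ((1 + lam / lam0) / 2)%R.
have lam_gt0 : (0 < lam)%R := lt_trans ltr01 lam1.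
have ll1 : (1 < lam / lam0)%R by rewrite ltr_pdivlMr// mul1r.
have q1 : (1 < q)%R by rewrite /q; lra.
have q0 : (0 <= q)%R by exact: ltW (lt_trans ltr01 q1).
pose r := (lam0 / lam)%R.
have r0 : (0 <= r)%R by rewrite divr_ge0 ?ltW.
have r1 : (r < 1)%R by rewrite ltr_pdivrMr// mul1r.
have qr1 : (q * r < 1)%R.
  have -> : (q * r = (r + 1) / 2)%R.
    by rewrite /q /r; field; rewrite !gt_eqF.
  lra.
have [M1 M10 powD] := powRD_le p0 q1.
pose c := (A * C * lam0)%R.
have c0 : (0 <= c)%R by rewrite !mulr_ge0// ltW.
pose C2 := (1 + q * c / (1 - q * r))%R.
have C20 : (0 <= C2)%R.
  apply: addr_ge0 => //; apply: divr_ge0; first exact: mulr_ge0.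
  by rewrite subr_ge0 ltW.
exists (C2 * (M1 + 1))%R => [|f eta M mf eta0 fM].
  by rewrite mulr_ge0// addr_ge0.
have mG : measurable G by exact: measurable_descent_domain.
pose h x := Num.max (`|f x| - eta)%R 0%R.
have h0 x : (0 <= h x)%R by rewrite le_max lexx orbT.
have hf x : (h x <= `|f x|)%R by rewrite ge_max normr_ge0 andbT lerBlDr lerDl.
have hh x z : (h x <= h z + `|f x - f z|)%R.
  rewrite /h ge_max addr_ge0// ?le_max ?lexx ?orbT// andbT.
  have : (`|f x| <= `|f z| + `|f x - f z|)%R.
    by have := ler_normD (f z) (f x - f z)%R; rewrite [(f z + _)%R]addrC subrK.
  have : (`|f z| - eta <= Num.max (`|f z| - eta) 0)%R by rewrite le_max lexx.
  by lra.
have mh : measurable_fun setT h.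
  apply: measurable_maxr => //; apply: measurable_funB => //.
  exact: measurableT_comp.
pose F x := (h x `^ p)%:E.
have mF : measurable_fun setT F.
  by apply/measurable_EFinP; exact: (measurableT_comp (measurable_powR p) mh).
have F0 x : 0 <= F x by rewrite lee_fin powR_ge0.
pose D x := \int[mu]_z (K (x, z) * (`|f x - f z| `^ p)%:E).
have mKf : measurable_fun [set: T * T]
    (fun xz => K xz * (`|f xz.1 - f xz.2| `^ p)%:E).
  by apply: emeasurable_funM => //; apply/measurable_EFinP; exact: measurable_diff_pow.
have Kf0 xz : 0 <= K xz * (`|f xz.1 - f xz.2| `^ p)%:E.
  by rewrite mule_ge0// lee_fin powR_ge0.
have mD : measurable_fun setT D by exact: (measurable_section_integral mu mKf).
have D0 x : 0 <= D x by apply: integral_ge0 => z _; exact: (Kf0 (x, z)).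
(* The source term: the cost of one jump on [G], and all of [F] off [G], where trajectories stop. *)
pose E x := M1%:E * D x + (\1_(~` G) x)%:E * F x.
have E0 x : 0 <= E x by rewrite adde_ge0// mule_ge0// lee_fin.
have mNG : measurable_fun setT (fun x => (\1_(~` G) x)%:E * F x).
  apply: emeasurable_funM => //; apply/measurable_EFinP/measurable_indic.
  exact: measurableC.
have mE : measurable_fun setT E.
  by apply: emeasurable_funD => //; exact: measurable_funeM.
(* On [G] the kernel has mass 1, so [F x] is its own average over z; [powD] compares it with [F z]
   inside the integral. *)
have FE x : F x <= E x + q%:E * \int[mu]_z (K (x, z) * F z).
  have mKF : measurable_fun setT (fun z => K (x, z) * F z).
    by apply: emeasurable_funM => //; exact: measurable_section.
  have [Gx|nGx] := pselect (G x); last first.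
    rewrite /E indicE mem_set//= mul1e addeAC leeDr// adde_ge0 ?mule_ge0 ?lee_fin//.
    by apply: integral_ge0 => z _; rewrite mule_ge0.
  rewrite /E indicE memNset; last by apply.
  rewrite mul0e adde0 -[leLHS]mul1e -(K1 Gx).
  have mKx := measurable_section x mK.
  have mKfx := measurable_section x mKf.
  rewrite -ge0_integralZr// -ge0_integralZl//.
  rewrite -ge0_integralZl//; last by move=> z _; rewrite mule_ge0.
  rewrite -ge0_integralD//; last 4 first.
  - by move=> z _; rewrite mule_ge0 ?lee_fin//; exact: (Kf0 (x, z)).
  - exact: measurable_funeM.
  - by move=> z _; rewrite mule_ge0 ?lee_fin ?mule_ge0.
  - exact: measurable_funeM.
  apply: ge0_integral_mono => z _; first by rewrite mule_ge0.
  rewrite /= (muleCA M1%:E) (muleCA q%:E) -ge0_muleDr ?mule_ge0 ?lee_fin ?powR_ge0//.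
  rewrite lee_wpmul2l// -!EFinM -EFinD lee_fin addrC.
  apply: le_trans (powD _ _ (h0 z) (normr_ge0 (f x - f z)%R)).
  by apply: ge0_ler_powR; rewrite ?nnegrE ?addr_ge0// ltW.
have FM z : (M <= Wp z)%R -> F z = 0.
  move=> /fM fz; rewrite /F /h max_r ?subr_le0//.
  by rewrite powR0// gt_eqF.
have K1' x : \int[mu]_z K (x, z) <= 1.
  have [/K1->//|nGx] := pselect (G x).
  by rewrite integral0_eq// => z _; exact: KG.
(* After n + 1 jumps W_+ is at least lam^(n+1) W_+(x) >= M, where the truncated function
   vanishes. *)
have wF x : (Wp x)%:E != 0 -> exists n, forall z, kiter mu K n (x, z) * F z = 0.
  move=> Wpx; have {}Wpx : (0 < Wp x)%R by rewrite lt_neqAle eq_sym -eqe Wpx Wp0.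
  have [n nM] := exists_expr_ge (M / Wp x) lam1.
  exists n => z; have [->|knz] := eqVneq (kiter mu K n (x, z)) 0; first by rewrite mul0e.
  rewrite FM ?mule0//.
  have [_ lxz] := kiter_support WWp lam1 Ksupp knz.
  by rewrite (le_trans _ (WWp z))// (le_trans _ lxz)// -ler_pdivrMr// nM.
have wk n z : \int[mu]_x ((Wp x)%:E * kiter mu K n (x, z)) <= (c * r ^+ n)%:E * (Wp z)%:E.
  exact: integral_weighted_kiter_le.
have mWpE : measurable_fun setT (EFin \o Wp) by exact/measurable_EFinP.
have := potential_bound mK K0 q0 c0 r0 qr1 mE E0 mF F0 mWpE Wp0 FE wF wk.
rewrite -/C2 => /le_trans; apply.
rewrite EFinM -muleA lee_wpmul2l ?lee_fin//.
have -> : \int[mu]_x ((EFin \o Wp) x * E x) =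
    \int[mu]_x ((Wp x)%:E * (M1%:E * D x) + (Wp x)%:E * ((\1_(~` G) x)%:E * F x)).
  by apply: eq_integral => x _; rewrite /E ge0_muleDr// mule_ge0// lee_fin.
rewrite ge0_integralD//; last 4 first.
- by move=> x _; rewrite !mule_ge0 ?lee_fin.
- by apply: emeasurable_funM => //; exact: measurable_funeM.
- by move=> x _; apply: mule_ge0; [rewrite lee_fin|apply: mule_ge0; [rewrite lee_fin|exact: F0]].
- exact: emeasurable_funM.
under eq_integral do rewrite muleCA.
set I := \int[mu]_(x in X0) _.
have I0 : 0 <= I by apply: integral_ge0 => x _; rewrite lee_fin mulr_ge0 ?powR_ge0.
have AJ0 : 0 <= A%:E * energy f by rewrite mule_ge0 ?lee_fin ?energy_ge0.
rewrite ge0_integralZl//; last 2 first.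
- exact: emeasurable_funM.
- by move=> x _; rewrite mule_ge0 ?lee_fin.
rewrite EFinD ge0_muleDl ?lee_fin// mul1e.
apply: leeD; first by rewrite lee_wpmul2l ?lee_fin// (le_trans (kernel_energy_le mf))// leeDl.
apply: (@le_trans _ _ I); last by rewrite leeDr.
rewrite /I [leRHS]integral_mkcond; apply: ge0_integral_mono => x _.
  by apply: mule_ge0; [rewrite lee_fin|apply: mule_ge0; [rewrite lee_fin|exact: F0]].
rewrite patchE -!EFinM.
have [Gx|nGx] := pselect (G x).
  rewrite indicE memNset; last by apply.
  rewrite mul0r mulr0; case: ifPn => // _.
  by rewrite lee_fin mulr_ge0 ?powR_ge0.
rewrite indicE mem_set// mul1r; case: ifPn => [_|/negP nX0].
  rewrite lee_fin mulrC ler_wpM2r//; apply: ge0_ler_powR; rewrite ?nnegrE//.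
  exact: ltW.
(* Outside both [G] and [X0] the weight is zero, so only [X0] contributes to the stopped part. *)
have : Wp x = 0%R.
  apply/eqP; rewrite eq_le Wp0 andbT leNgt; apply/negP => Wpx; apply: nGx.
  by split => // X0x; apply: nX0; rewrite inE.
by move=> ->; rewrite mul0r.
Qed.

Context (X0cond : X0 !=set0 -> X0 `*` X0 `<=` U /\
    exists C'' : R, forall x y, X0 x -> X0 y ->
      (Wp x)%:E * mu (uball U y) <= (C'' * W y)%:E * mu X0).

(** Removal of the truncation. Where |f| >= 2 eta one has |f| <= 2 (|f| - eta)_+, which costs the
    factor 2^p; with eta = 1/(n+1) these sets exhaust the set where f is nonzero, and monotone
    convergence concludes. In the constant, A comes from the jumps and C3 from X0. *)
Lemma weighted_poincare : exists C' : R, forall f, measurable_fun setT f ->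
  \int[mu]_(x in X0) (f x)%:E = 0 ->
  (forall eta : R, (0 < eta)%R ->
    exists M : R, forall x, (M <= Wp x)%R -> (`|f x| <= eta)%R) ->
  \int[mu]_x (`|f x| `^ p * Wp x)%:E <= C'%:E * energy f.
Proof.
have [C3 C30 hC3] := exceptional_bound X0cond.
have [C1 C10 hC1] := truncated_bound.
pose P := (2 `^ p : R)%R.
have P0 : (0 <= P)%R by exact: powR_ge0.
exists (P * (C1 * (A + C3)))%R => f mf f0 fW.
have J0 := energy_ge0 f.
set B := _%:E * energy f.
pose S (n : nat) := [set x | (2 * n.+1%:R^-1 <= `|f x|)%R].
have mnf : measurable_fun setT (fun x => `|f x|)%R by exact: measurableT_comp.
have mS n : measurable (S n).
  by rewrite -[X in measurable X]setTI; exact: measurable_fun_le.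
pose g n x := (`|f x| `^ p * Wp x * \1_(S n) x)%:E.
have g0 n x : 0 <= g n x by rewrite lee_fin !mulr_ge0 ?powR_ge0.
have mg n : measurable_fun setT (g n).
  apply/measurable_EFinP/measurable_funM; last exact: measurable_indic.
  by apply: measurable_funM => //; exact: (measurableT_comp (measurable_powR p) mnf).
have gB n : \int[mu]_x g n x <= B.
  pose eta : R := n.+1%:R^-1%R.
  have eta0 : (0 < eta)%R by rewrite invr_gt0.
  have [M fM] := fW _ eta0.
  pose h x := Num.max (`|f x| - eta)%R 0%R.
  have mh : measurable_fun setT h.
    by apply: measurable_maxr => //; exact: measurable_funB.
  have hp0 x : 0 <= (Wp x)%:E * (h x `^ p)%:E.
    by rewrite -EFinM lee_fin mulr_ge0 ?powR_ge0.
  apply: (@le_trans _ _ (\int[mu]_x (P%:E * ((Wp x)%:E * (h x `^ p)%:E)))).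
    apply: ge0_integral_mono => x _ //.
    rewrite /g indicE; have [/set_mem Sx|_] := boolP (x \in S n); last first.
      by rewrite mulr0 mule_ge0.
    rewrite mulr1 -!EFinM lee_fin mulrCA [leRHS]mulrC [leLHS]mulrC.
    rewrite [leRHS]mulrC ler_wpM2l//.
    have f2h : (`|f x| <= 2 * h x)%R.
      have : (`|f x| - eta <= h x)%R by rewrite le_max lexx.
      by move: Sx; rewrite /S/= -/eta; lra.
    have h0 : (0 <= h x)%R by rewrite le_max lexx orbT.
    rewrite /P -powRM//; apply: ge0_ler_powR; rewrite ?nnegrE ?mulr_ge0//.
    exact: ltW.
  rewrite ge0_integralZl//; last first.
    apply: emeasurable_funM; first exact/measurable_EFinP.
    by apply/measurable_EFinP; exact: (measurableT_comp (measurable_powR p) mh).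
  rewrite /B EFinM -muleA lee_wpmul2l//.
  apply: (le_trans (hC1 _ _ _ mf (ltW eta0) fM)).
  rewrite EFinM -muleA lee_wpmul2l// EFinD ge0_muleDl//.
  by rewrite leeD2l//; exact: hC3.
have ndg x : setT x -> {homo g ^~ x : n k / (n <= k)%N >-> n <= k}.
  move=> _ n k nk; rewrite lee_fin ler_wpM2l ?mulr_ge0 ?powR_ge0//.
  rewrite !indicE; have [/set_mem/= Sn|//] := boolP (x \in S n).
  rewrite mem_set//=; apply: le_trans Sn.
  by rewrite ler_pM2l// lef_pV2 ?posrE ?ltr0n// ler_nat.
have -> : \int[mu]_x (`|f x| `^ p * Wp x)%:E = \int[mu]_x limn (g ^~ x).
  apply: eq_integral => x _; apply/esym/cvg_lim => //; apply: cvg_near_cst.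
  have [fx0|fx0] := eqVneq (f x) 0%R.
    by apply: nearW => n; rewrite /g fx0 normr0 powR0 ?gt_eqF// !mul0r.
  have afx : (0 < `|f x| / 2)%R by rewrite divr_gt0// normr_gt0.
  near=> n; rewrite /g indicE mem_set ?mulr1// /S/=.
  rewrite mulrC -ler_pdivlMr//.
  rewrite -[leRHS]invrK lef_pV2 ?posrE ?invr_gt0//.
  apply: (@le_trans _ _ n%:R); last by rewrite ler_nat.
  by near: n; exact: nbhs_infty_ger.
rewrite (monotone_convergence _ _ mg)//.
apply: lime_le; last exact: nearW.
apply: ereal_nondecreasing_is_cvgn => n k nk; apply: ge0_integral_mono => x _ //.
exact: ndg.
Unshelve. all: by end_near.
Qed.

End WeightedPoincare.

(** * Passage from the measurable setting to the topological one *)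

Theorem theorem1 (R : realType) (X : ptopologicalType)
  (mu : {sigma_finite_measure set (borel X) -> \bar R})
  (U : set (X * X)) (C lam0 : R) (W Wp : X -> R) (X0 : set X) (p : R)
  (U_open : open U)
  (U_diag : forall x, U (x, x))
  (U_meas : measurable (U : set (borel X * borel X)))
  (mu_ball : forall x, (0 < mu (uball U x) < +oo)%E)
  (C_gt0 : 0 < C) (lam0_gt0 : 0 < lam0)
  (growth : forall x n, (0 < n)%N ->
    (mu (uball_iter U n x) <= (C * lam0 ^+ n)%:E * mu (uball U x))%E)
  (W_adm : admissible mu U lam0 W Wp X0)
  (ball_bnd : forall x, ~ X0 x -> 0 < Wp x ->
    exists M : R, forall y, U (y, x) -> (mu (uball U y) <= M%:E)%E)
  (p_ge1 : 1 <= p) :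
  exists C' : R, forall f : X -> R,
    measurable_fun [set: borel X] f ->
    (\int[mu]_(x in X0) (f x)%:E = 0)%E ->
    (forall eta : R, 0 < eta ->
      exists M : R, forall x, M <= Wp x -> `|f x| <= eta) ->
    (\int[mu]_x (`|f x| `^ p * Wp x)%:E <=
     C'%:E * \int[mu]_x
       (((fine (mu (uball U x)))^-1)%:E *
         (\int[mu]_(y in uball U x) (`|f x - f y| `^ p)%:E) * (W x)%:E))%E.
Proof.
have [[mW mWp W0 WWp mX0] [lam [eps [s [lamlam0 eps0 s01 adm X0cond]]]]] := W_adm.
have oU x : open (uball U x).
  have -> : uball U x = (fun y => (x, y)) @^-1` U.
    by apply/seteqP; split => y; rewrite /uball /xsection/= inE.
  by apply: open_comp => // y _; apply: cvg_pair; [exact: cvg_cst|exact: cvg_id].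
(* The unions defining iterated balls may be uncountable, so measurability is obtained from
   openness, which they preserve. *)
have mUn n x : measurable (uball_iter U n x : set (borel X)).
  apply: sub_sigma_algebra; rewrite /uball_iter.
  by elim: n.-1 => [|k IH] /=; [exact: oU|apply: bigcup_open].
(* The growth condition at a single point suffices; the base point of [X] is taken. *)
have lam0_ge1 := growth_constant_ge1 U_meas U_diag (mu_ball point) lam0_gt0
  (fun n => mUn n point) (growth point).
have lam1 : 1 < lam := le_lt_trans lam0_ge1 lamlam0.
have [K [mK K0 K1 KG [Ksupp Kle]]] := exists_descent_kernel
  U_meas U_diag mu_ball mW mWp W0 mX0 lam1 eps0 s01 adm ball_bnd.
have A0 : 0 <= 2 / eps by rewrite divr_ge0// ltW.
have [C' hC'] := weighted_poincare U_meas mu_ball mW mWp W0 WWp mX0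
  p_ge1 C_gt0 lam0_gt0 mUn growth lam1 lamlam0 A0 mK K0 K1 KG Ksupp Kle X0cond.
exists C' => f mf f0 fW.
by rewrite -(energyE p U_meas mu_ball W0 mf); exact: hC'.
Qed.
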